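(* Let $(A,\partial,\bar\partial,\cdot)$ be a bidifferential bigraded algebra over a field of characteristic zero, and let $[x],[y],[z]\in H_{BC}(A)$ be classes with $[x]\cdot[y]=[y]\cdot[z]=0$. Let $(f,g,h)$ be a contraction of $A$ into $(H_{ABC}(A),\partial,\bar\partial)$ obtained from a contraction of $A$ into a minimal bicomplex $H$ and an identification $H\cong H_{ABC}(A)$, and let $\mu_3$ be the transferred ternary operation of bidegree $(-1,-1)$. Then $$[g\,\mu_3([x],[y],[z])]_{A}\in\langle[x],[y],[z]\rangle,$$ where $[-]_A$ denotes the Aeppli cohomology class.
   Context: A bidifferential bigraded algebra is a bigraded vector space with linear maps $\partial$, $\bar\partial$ of bidegrees $(1,0)$, $(0,1)$ with $\partial^2=\bar\partial^2=\partial\bar\partial+\bar\partial\partial=0$ and an associative product of bidegree $(0,0)$ for which both are derivations (Koszul signs for total degree). $H_{BC}(A)=\frac{\ker\partial\cap\ker\bar\partial}{\operatorname{Im}\partial\bar\partial}$ is an algebra, and $H_A(A)=\frac{\ker\partial\bar\partial}{\operatorname{Im}\partial+\operatorname{Im}\bar\partial}$ is a module over it. $\widetilde H_A(A)=\frac{\ker\partial\bar\partial}{\operatorname{Im}\partial+\operatorname{Im}\bar\partial+\ker\partial\cap\ker\bar\partial}$ and $H_{ABC}(A)=H_{BC}(A)\oplus\widetilde H_A(A)$, a bicomplex with $\partial\bar\partial=0$, the differentials being induced by those of $A$ (zero on $H_{BC}(A)$, and $[a]\mapsto[\partial a]$, $[a]\mapsto[\bar\partial a]$ from $\widetilde H_A(A)$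 to $H_{BC}(A)$). For $[x],[y],[z]\in H_{BC}(A)$ with $[x][y]=[y][z]=0$, the triple ABC-Massey product is the set $\langle[x],[y],[z]\rangle=\{[x\cdot v-u\cdot z]\mid\partial\bar\partial u=x\cdot y,\ \partial\bar\partial v=y\cdot z\}\subset H_A(A)$ (the representatives $x,y,z$ being chosen). A contraction of $A$ into a bicomplex $B$ consists of morphisms of bicomplexes $f\colon A\to B$, $g\colon B\to A$ with $fg=\mathrm{id}_B$ and a linear map $h\colon A\to A$ of bidegree $(-1,-1)$ with $gf-\mathrm{id}_A=[\partial,[\bar\partial,h]]$, $[-,-]$ being the graded commutator. A bicomplex $H$ is minimal if $\partial\bar\partial=0$ on $H$. Given a contraction of $A$ into a minimal bicomplex $H$, one takes $f\colon A\to H\xrightarrow{\cong}H_{ABC}(A)$ and $g\colon H_{ABC}(A)\xrightarrow{\cong}H\to A$; the identification $H\cong H_{ABC}(A)$ is such that for $[x]\in H_{BC}(A)\subseteq H_{ABC}(A)$ the element $g([x])$ is a Bott-Chern cocycle representing $[x]$; the representatives used in the statement are $x=g([x])$, $y=g([y])$, $z=g([z])$. Writing $m$ for the product of $A$, the transferred operation is $\mu_3=\mu_3^{-1,-1}=f\,m(h\,m(g,g),g)-f\,m(g,h\,m(g,g))\colon H_{ABC}(A)^{\otimes3}\to H_{ABC}(A)$. *)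

(* Defs.v *)
From HB Require Import structures.
From mathcomp Require Import all_boot all_order all_algebra.
From mathcomp Require Import boolp classical_sets.

Set Implicit Arguments.
Unset Strict Implicit.
Unset Printing Implicit Defensive.

Import GRing.Theory.
Local Open Scope ring_scope.
Local Open Scope quotient_scope.

Section Subspace.
Variables (k : fieldType) (V : lmodType k) (Z : submodClosed V).

Record subspace := Subspace { subspace_val :> V; _ : subspace_val \in Z }.

HB.instance Definition _ := [isSub for subspace_val].
HB.instance Definition _ := [Choice of subspace by <:].
HB.instance Definition _ := [SubChoice_isSubLmodule of subspace by <:].

Lemma subspace_valP (z : subspace) : subspace_val z \in Z.
Proof. by case: z. Qed.

Fact subspace_val_linear : linear subspace_val.
Proof. exact: (linearP (\val : subspace -> V)). Qed.
HB.instance Definition _ :=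
  GRing.isLinear.Build k subspace V *:%R subspace_val subspace_val_linear.

Lemma subspaceB (x y : subspace) : subspace_val x - subspace_val y \in Z.
Proof.
have [_ ZB] := GRing.submod_closedB (submodClosedP Z).
by apply: ZB; exact: subspace_valP.
Qed.

End Subspace.

Section Subquotient.
Variables (k : fieldType) (V : lmodType k) (Z B : submodClosed V).

Definition bounds : {pred subspace Z} := [pred z | subspace_val z \in B].

Fact bounds_submod_closed : subsemimod_closed bounds.
Proof.
split; [split|] => [|x y|c x]; rewrite !inE /=.
- exact: rpred0.
- exact: rpredD.
- exact: rpredZ.
Qed.
HB.instance Definition _ :=
  GRing.isSubmodClosed.Build k (subspace Z) bounds bounds_submod_closed.

(** The quotient Z / (Z :&: B). *)
Definition subquot : Type := Quotient.quot bounds.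
HB.instance Definition _ := GRing.Zmodule.on subquot.

Definition cls (z : subspace Z) : subquot := \pi_(Quotient.quot bounds) z.

Lemma clsP (x y : subspace Z) : (cls x = cls y) <-> (subspace_val x - subspace_val y \in B).
Proof.
rewrite -[_ \in B]/(x - y \in bounds) Quotient.idealrBE.
by split=> [/eqP | /eqP].
Qed.

Definition rep (x : subquot) : subspace Z := repr (x : Quotient.quot bounds).

Lemma repK : cancel rep cls.
Proof. exact: reprK. Qed.

Lemma cls_surj (x : subquot) : exists z, x = cls z.
Proof. by exists (rep x); rewrite repK. Qed.

Lemma clsB : {morph cls : x y / x - y}.
Proof. by move=> x y; rewrite /cls raddfB. Qed.
HB.instance Definition _ :=
  GRing.isZmodMorphism.Build (subspace Z) subquot cls clsB.

Definition subquot_scale (c : k) (x : subquot) : subquot :=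
  cls (c *: rep x).

Lemma subquot_scaleE c z : subquot_scale c (cls z) = cls (c *: z).
Proof.
apply/clsP; rewrite /= -scalerBr; apply: rpredZ.
by apply/clsP; rewrite repK.
Qed.

Fact subquot_scaleA a b v :
  subquot_scale a (subquot_scale b v) = subquot_scale (a * b) v.
Proof. by have [z ->] := cls_surj v; rewrite !subquot_scaleE scalerA. Qed.
Fact subquot_scale1 : left_id 1 subquot_scale.
Proof. by move=> v; have [z ->] := cls_surj v; rewrite subquot_scaleE scale1r. Qed.
Fact subquot_scaleDr : right_distributive subquot_scale +%R.
Proof.
move=> c u v; have [y ->] := cls_surj u; have [z ->] := cls_surj v.
by rewrite -raddfD !subquot_scaleE scalerDr raddfD.
Qed.
Fact subquot_scaleDl v : {morph subquot_scale^~ v : a b / a + b}.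
Proof.
by move=> a b; have [z ->] := cls_surj v; rewrite !subquot_scaleE scalerDl raddfD.
Qed.
HB.instance Definition _ := GRing.Zmodule_isLmodule.Build k subquot
  subquot_scaleA subquot_scale1 subquot_scaleDr subquot_scaleDl.

Lemma cls_scalable : scalable cls.
Proof. by move=> c z; rewrite -subquot_scaleE. Qed.
HB.instance Definition _ :=
  GRing.isScalable.Build k (subspace Z) subquot *:%R cls cls_scalable.

End Subquotient.
Arguments cls {k V Z B} z.

Section InducedMap.
Variables (k : fieldType) (V : lmodType k) (Z B Z' B' : submodClosed V).
Variable phi : {linear V -> V}.
Hypothesis phiZ : forall a, a \in Z -> phi a \in Z'.
Hypothesis phiB : forall a, a \in Z -> a \in B -> phi a \in B'.

Definition subspace_map (z : subspace Z) : subspace Z' :=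
  Subspace (phiZ (subspace_valP z)).

Definition subquot_map_fun (x : subquot Z B) : subquot Z' B' :=
  cls (subspace_map (rep x)).

Lemma subquot_map_funE z : subquot_map_fun (cls z) = cls (subspace_map z).
Proof.
apply/clsP; rewrite /= -raddfB; apply: phiB; last by apply/clsP; rewrite repK.
exact: subspaceB.
Qed.

Fact subquot_map_linear : linear subquot_map_fun.
Proof.
move=> c x y; have [u ->] := cls_surj x; have [v ->] := cls_surj y.
rewrite -linearP !subquot_map_funE -linearP; congr (cls _).
by apply: val_inj; rewrite /= !linearP.
Qed.
HB.instance Definition _ := GRing.isLinear.Build k (subquot Z B)
  (subquot Z' B') *:%R subquot_map_fun subquot_map_linear.

Definition subquot_map : {linear subquot Z B -> subquot Z' B'} := subquot_map_fun.

Lemma subquot_mapE z : subquot_map (cls z) = cls (subspace_map z).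
Proof. exact: subquot_map_funE. Qed.

End InducedMap.
Arguments subspace_map {k V Z Z' phi} phiZ z.
Arguments subquot_map {k V Z B Z' B' phi} phiZ phiB.

(** A bigrading V = (+)_(p,q) V_(p,q) is given by the projections onto the
    summands; V_(p,q) is the range of [proj (p, q)]. *)
Record bigraded (k : fieldType) := Bigraded {
  bg_space :> lmodType k;
  proj : int * int -> {linear bg_space -> bg_space};
  proj_idem : forall i a, proj i (proj i a) = proj i a;
  proj_orth : forall i j a, i != j -> proj i (proj j a) = 0;
  proj_sum : forall a,
    exists2 s : seq (int * int), uniq s & a = \sum_(i <- s) proj i a
}.
Arguments proj {k V} i : rename.

Definition homog (k : fieldType) (V : bigraded k) (i : int * int) (a : V) :=
  proj i a = a.

Definition has_bidegree (k : fieldType) (V W : bigraded k) (e : int * int)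
    (phi : V -> W) :=
  forall i a, homog i a -> homog (i + e) (phi a).

Section BigradedTheory.
Variable k : fieldType.
Implicit Types V W : bigraded k.

Lemma proj_homog V i (a : V) : homog i (proj i a).
Proof. exact: proj_idem. Qed.

Lemma proj_sum_sub V (a : V) : exists2 s : seq (int * int), uniq s &
  forall t, uniq t -> {subset s <= t} -> a = \sum_(i <- t) proj i a.
Proof.
have [s us def_a] := proj_sum a; exists s => // t ut st.
rewrite (bigID (mem s)) /= [X in _ + X]big1 ?addr0 => [|j js].
  rewrite {1}def_a -[RHS]big_filter; apply: perm_big; apply: uniq_perm.
  - exact: us.
  - exact: filter_uniq.
  - by move=> i; rewrite mem_filter andb_idr //; exact: st.
rewrite def_a raddf_sum big_seq big1 // => i si.
by apply: proj_orth; apply: contraNneq js => ->.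
Qed.


Lemma has_bidegree_proj V W e (phi : {linear V -> W}) :
  has_bidegree e phi -> forall i a, proj (i + e) (phi a) = phi (proj i a).
Proof.
move=> phie i a; have [s us def_a] := proj_sum a.
have [si|sNi] := boolP (i \in s).
  rewrite {1}def_a !raddf_sum (bigD1_seq i) //= (phie _ _ (proj_homog _ _)).
  rewrite big1 ?addr0 // => j ji; have <- := phie _ _ (proj_homog j a).
  by rewrite proj_orth // (inj_eq (addIr e)) eq_sym.
have -> : proj i a = 0.
  rewrite def_a raddf_sum big_seq big1 // => j sj.
  by apply: proj_orth; apply: contraNneq sNi => ->.
rewrite raddf0 {1}def_a !raddf_sum big_seq big1 // => j sj /=.
have <- := phie _ _ (proj_homog j a); rewrite proj_orth // (inj_eq (addIr e)).
by apply: contraNneq sNi => ->.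
Qed.

End BigradedTheory.

Section SubquotBigraded.
Variables (k : fieldType) (V : bigraded k) (Z B : submodClosed V).
Hypothesis projZ : forall i (a : V), a \in Z -> proj i a \in Z.
Hypothesis projB : forall i (a : V), a \in B -> proj i a \in B.

Definition subquot_proj i : {linear subquot Z B -> subquot Z B} :=
  subquot_map (@projZ i) (fun a _ => @projB i a).

Fact subquot_proj_idem i x : subquot_proj i (subquot_proj i x) = subquot_proj i x.
Proof.
have [z ->] := cls_surj x; rewrite /subquot_proj !subquot_mapE; congr (cls _).
by apply: val_inj; rewrite /= proj_idem.
Qed.

Fact subquot_proj_orth i j x : i != j -> subquot_proj i (subquot_proj j x) = 0.
Proof.
move=> ij; have [z ->] := cls_surj x; rewrite /subquot_proj !subquot_mapE -(raddf0 cls).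
by congr (cls _); apply: val_inj; rewrite /= proj_orth.
Qed.

Fact subquot_proj_sum x : exists2 s : seq (int * int), uniq s &
  x = \sum_(i <- s) subquot_proj i x.
Proof.
have [z ->] := cls_surj x; have [s us def_z] := proj_sum (subspace_val z).
exists s => //; under eq_bigr do rewrite /subquot_proj subquot_mapE.
rewrite -raddf_sum; congr (cls _); apply: val_inj.
by rewrite [RHS](raddf_sum (@subspace_val k V Z)).
Qed.

Definition subquot_bigraded : bigraded k :=
  Bigraded subquot_proj_idem subquot_proj_orth subquot_proj_sum.

End SubquotBigraded.

Section SumBigraded.
Variables (k : fieldType) (V W : bigraded k).

Definition sum_proj_fun i (x : (V * W)%type) : (V * W)%type := (proj i x.1, proj i x.2).

Fact sum_proj_linear i : linear (sum_proj_fun i).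
Proof. by move=> c x y; rewrite /sum_proj_fun !linearP. Qed.
HB.instance Definition _ i := GRing.isLinear.Build k (V * W)%type (V * W)%type
  *:%R (sum_proj_fun i) (sum_proj_linear i).

Definition sum_proj i : {linear (V * W)%type -> (V * W)%type} := sum_proj_fun i.

Fact sum_proj_idem i x : sum_proj i (sum_proj i x) = sum_proj i x.
Proof. by rewrite /= /sum_proj_fun /= !proj_idem. Qed.

Fact sum_proj_orth i j x : i != j -> sum_proj i (sum_proj j x) = 0.
Proof. by move=> ij; rewrite /= /sum_proj_fun /= !proj_orth. Qed.

Fact sum_proj_sum x : exists2 s : seq (int * int), uniq s &
  x = \sum_(i <- s) sum_proj i x.
Proof.
have [s1 _ def1] := proj_sum_sub x.1; have [s2 _ def2] := proj_sum_sub x.2.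
exists (undup (s1 ++ s2)); first exact: undup_uniq.
have [sub1 sub2] : {subset s1 <= undup (s1 ++ s2)} /\
                   {subset s2 <= undup (s1 ++ s2)}.
  by split=> i si; rewrite mem_undup mem_cat si ?orbT.
rewrite [LHS]surjective_pairing.
rewrite [X in (X, _)](def1 _ (undup_uniq _) sub1).
rewrite [X in (_, X)](def2 _ (undup_uniq _) sub2).
elim: (undup _) => [|i t IHt]; first by rewrite !big_nil.
by rewrite !big_cons -IHt.
Qed.

Definition sum_bigraded : bigraded k :=
  Bigraded sum_proj_idem sum_proj_orth sum_proj_sum.

End SumBigraded.

Record bicomplex (k : fieldType) := Bicomplex {
  bc_space :> bigraded k;
  del : {linear bc_space -> bc_space};
  delb : {linear bc_space -> bc_space};
  del_bidegree : has_bidegree (1, 0) del;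
  delb_bidegree : has_bidegree (0, 1) delb;
  del_del : forall a, del (del a) = 0;
  delb_delb : forall a, delb (delb a) = 0;
  del_delb : forall a, del (delb a) + delb (del a) = 0
}.
Arguments del {k b}.
Arguments delb {k b}.

Definition minimal (k : fieldType) (H : bicomplex k) :=
  forall a : H, del (delb a) = 0.

Record bc_morphism (k : fieldType) (A B : bicomplex k) := BcMorphism {
  bc_fun :> {linear A -> B};
  bc_fun_bidegree : has_bidegree 0 bc_fun;
  bc_fun_del : forall a, bc_fun (del a) = del (bc_fun a);
  bc_fun_delb : forall a, bc_fun (delb a) = delb (bc_fun a)
}.

Record bc_iso (k : fieldType) (A B : bicomplex k) := BcIso {
  iso_to : bc_morphism A B;
  iso_from : bc_morphism B A;
  iso_toK : cancel iso_to iso_from;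
  iso_fromK : cancel iso_from iso_to
}.

Section CompMorphism.
Variables (k : fieldType) (A B C : bicomplex k).
Variables (phi : bc_morphism B C) (psi : bc_morphism A B).

Fact bc_comp_bidegree : has_bidegree 0 (phi \o psi).
Proof.
move=> i a ha; rewrite -[i + 0]addr0 /=.
by apply: bc_fun_bidegree; apply: bc_fun_bidegree.
Qed.
Fact bc_comp_del a : (phi \o psi) (del a) = del ((phi \o psi) a).
Proof. by rewrite /= !bc_fun_del. Qed.
Fact bc_comp_delb a : (phi \o psi) (delb a) = delb ((phi \o psi) a).
Proof. by rewrite /= !bc_fun_delb. Qed.

Definition bc_comp : bc_morphism A C :=
  BcMorphism bc_comp_bidegree bc_comp_del bc_comp_delb.

End CompMorphism.

(** The graded commutator of maps phi and psi of total degrees m and n. *)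
Definition gcomm (k : fieldType) (V : lmodType k) (m n : int)
    (phi psi : V -> V) (a : V) : V :=
  phi (psi a) - ((-1 : k) ^ (m * n)) *: psi (phi a).

(** h has total degree -2 and [delb, h] has total degree -1. *)
Record contraction (k : fieldType) (A B : bicomplex k) := Contraction {
  contr_f : bc_morphism A B;
  contr_g : bc_morphism B A;
  contr_h : {linear A -> A};
  contr_h_bidegree : has_bidegree (-1, -1) contr_h;
  contr_fg : forall b, contr_f (contr_g b) = b;
  contr_gf : forall a, contr_g (contr_f a) - a =
    gcomm 1 (-1) del (gcomm 1 (-2) delb contr_h) a
}.

Section ContractionIso.
Variables (k : fieldType) (A H H' : bicomplex k).
Variables (C : contraction A H) (phi : bc_iso H H').

Fact contr_iso_fg b :
  bc_comp (iso_to phi) (contr_f C) (bc_comp (contr_g C) (iso_from phi) b) = b.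
Proof. by rewrite /= contr_fg iso_fromK. Qed.
Fact contr_iso_gf a :
  bc_comp (contr_g C) (iso_from phi) (bc_comp (iso_to phi) (contr_f C) a) - a =
  gcomm 1 (-1) del (gcomm 1 (-2) delb (contr_h C)) a.
Proof. by rewrite /= iso_toK contr_gf. Qed.

(** (phi f, g phi^-1, h), for phi : H -> H' an isomorphism. *)
Definition contr_iso : contraction A H' :=
  Contraction (@contr_h_bidegree _ _ _ C) contr_iso_fg contr_iso_gf.

End ContractionIso.

Section Cohomology.
Variables (k : fieldType) (A : bicomplex k).

Definition cocyclesBC : {pred A} := [pred a : A | (del a == 0) && (delb a == 0)].
Definition cocyclesA : {pred A} := [pred a : A | del (delb a) == 0].
Definition boundsBC : {pred A} := [pred a : A | `[< exists b, a = del (delb b) >]].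
Definition boundsA : {pred A} :=
  [pred a : A | `[< exists b c, a = del b + delb c >]].
Definition bounds_redA : {pred A} :=
  [pred a : A | `[< exists b c e, e \in cocyclesBC /\ a = del b + delb c + e >]].

Fact cocyclesBC_closed : subsemimod_closed cocyclesBC.
Proof.
split; [split|] => [|x y|c x]; rewrite !inE.
- by rewrite !raddf0 eqxx.
- by move=> /andP[/eqP x1 /eqP x2] /andP[/eqP y1 /eqP y2];
     rewrite !raddfD /= x1 x2 y1 y2 addr0 eqxx.
- by move=> /andP[/eqP x1 /eqP x2]; rewrite !linearZ /= x1 x2 scaler0 eqxx.
Qed.
HB.instance Definition _ :=
  GRing.isSubmodClosed.Build k A cocyclesBC cocyclesBC_closed.

Fact cocyclesA_closed : subsemimod_closed cocyclesA.
Proof.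
split; [split|] => [|x y|c x]; rewrite !inE.
- by rewrite !raddf0 eqxx.
- by move=> /eqP x1 /eqP y1; rewrite !raddfD /= x1 y1 addr0 eqxx.
- by move=> /eqP x1; rewrite !linearZ /= x1 scaler0 eqxx.
Qed.
HB.instance Definition _ :=
  GRing.isSubmodClosed.Build k A cocyclesA cocyclesA_closed.

Fact boundsBC_closed : subsemimod_closed boundsBC.
Proof.
split; [split|] => [|x y|c x]; rewrite !inE.
- by exists 0; rewrite !raddf0.
- move=> [b ->] [b' ->].
  by exists (b + b'); rewrite !raddfD.
- by move=> [b ->]; exists (c *: b); rewrite !linearZ.
Qed.
HB.instance Definition _ :=
  GRing.isSubmodClosed.Build k A boundsBC boundsBC_closed.

Fact boundsA_closed : subsemimod_closed boundsA.
Proof.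
split; [split|] => [|x y|c x]; rewrite !inE.
- by exists 0, 0; rewrite !raddf0 addr0.
- move=> [b [c ->]] [b' [c' ->]].
  by exists (b + b'), (c + c'); rewrite !raddfD addrACA.
- move=> [b [d ->]]; exists (c *: b), (c *: d).
  by rewrite !linearZ scalerDr.
Qed.
HB.instance Definition _ :=
  GRing.isSubmodClosed.Build k A boundsA boundsA_closed.

Fact bounds_redA_closed : subsemimod_closed bounds_redA.
Proof.
split; [split|] => [|x y|c x]; rewrite !inE.
- by exists 0, 0, 0; split; [exact: rpred0 | rewrite !raddf0 !addr0].
- move=> [b [c [e [he ->]]]] [b' [c' [e' [he' ->]]]].
  exists (b + b'), (c + c'), (e + e'); split; first exact: rpredD.
  by rewrite !raddfD addrACA; congr (_ + _); rewrite addrACA.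
- move=> [b [d [e [he ->]]]].
  exists (c *: b), (c *: d), (c *: e); split; first exact: rpredZ.
  by rewrite !linearZ !scalerDr.
Qed.
HB.instance Definition _ :=
  GRing.isSubmodClosed.Build k A bounds_redA bounds_redA_closed.

(** [HBC] is H_BC(A), [HA] is H_A(A) and [HredA] is \widetilde H_A(A). *)
Definition HBC := subquot cocyclesBC boundsBC.
Definition HA := subquot cocyclesA boundsA.
Definition HredA := subquot cocyclesA bounds_redA.


Lemma del_proj i (a : A) : del (proj i a) = proj (i + (1, 0)) (del a).
Proof. by rewrite (has_bidegree_proj (@del_bidegree _ A)). Qed.
Lemma delb_proj i (a : A) : delb (proj i a) = proj (i + (0, 1)) (delb a).
Proof. by rewrite (has_bidegree_proj (@delb_bidegree _ A)). Qed.

Lemma proj_del i (a : A) : proj i (del a) = del (proj (i - (1, 0)) a).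
Proof. by rewrite del_proj subrK. Qed.
Lemma proj_delb i (a : A) : proj i (delb a) = delb (proj (i - (0, 1)) a).
Proof. by rewrite delb_proj subrK. Qed.

Lemma delbE (a : A) : delb (del a) = - del (delb a).
Proof. by apply/eqP; rewrite -addr_eq0 addrC del_delb. Qed.

Fact cocyclesBC_proj i (a : A) : a \in cocyclesBC -> proj i a \in cocyclesBC.
Proof.
by rewrite !inE del_proj delb_proj => /andP[/eqP-> /eqP->]; rewrite !raddf0 eqxx.
Qed.
Fact cocyclesA_proj i (a : A) : a \in cocyclesA -> proj i a \in cocyclesA.
Proof. by rewrite !inE delb_proj del_proj => /eqP->; rewrite raddf0. Qed.
Fact boundsBC_proj i (a : A) : a \in boundsBC -> proj i a \in boundsBC.
Proof.
rewrite !inE => -[b ->].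
by rewrite proj_del proj_delb; eexists.
Qed.
Fact bounds_redA_proj i (a : A) : a \in bounds_redA -> proj i a \in bounds_redA.
Proof.
rewrite !inE => -[b [c [e [he ->]]]].
rewrite !raddfD /= proj_del proj_delb; do 3 eexists; split; last by [].
exact: cocyclesBC_proj.
Qed.

Definition HBC_bigraded : bigraded k :=
  subquot_bigraded cocyclesBC_proj boundsBC_proj.
Definition HredA_bigraded : bigraded k :=
  subquot_bigraded cocyclesA_proj bounds_redA_proj.

Fact del_cocyclesA (a : A) : a \in cocyclesA -> del a \in cocyclesBC.
Proof. by rewrite !inE delbE => /eqP->; rewrite del_del oppr0 eqxx. Qed.
Fact delb_cocyclesA (a : A) : a \in cocyclesA -> delb a \in cocyclesBC.
Proof. by rewrite !inE => /eqP->; rewrite delb_delb eqxx. Qed.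
Fact del_bounds_redA (a : A) :
  a \in cocyclesA -> a \in bounds_redA -> del a \in boundsBC.
Proof.
rewrite !inE => _ [b [c [e [he ->]]]]; exists c.
by move: he; rewrite inE !raddfD /= del_del => /andP[/eqP-> _]; rewrite add0r addr0.
Qed.
Fact delb_bounds_redA (a : A) :
  a \in cocyclesA -> a \in bounds_redA -> delb a \in boundsBC.
Proof.
rewrite !inE => _ [b [c [e [he ->]]]]; exists (- b).
move: he; rewrite inE !raddfD /= delb_delb delbE => /andP[_ /eqP->].
by rewrite !addr0 !raddfN.
Qed.

Definition HredA_del : {linear HredA -> HBC} :=
  subquot_map del_cocyclesA del_bounds_redA.
Definition HredA_delb : {linear HredA -> HBC} :=
  subquot_map delb_cocyclesA delb_bounds_redA.

Lemma HredA_delE z : HredA_del (cls z) = cls (subspace_map del_cocyclesA z).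
Proof. exact: subquot_mapE. Qed.
Lemma HredA_delbE z : HredA_delb (cls z) = cls (subspace_map delb_cocyclesA z).
Proof. exact: subquot_mapE. Qed.

Definition HABC_bigraded : bigraded k := sum_bigraded HBC_bigraded HredA_bigraded.

Definition HABC_del_fun (x : HABC_bigraded) : HABC_bigraded := (HredA_del x.2, 0).
Definition HABC_delb_fun (x : HABC_bigraded) : HABC_bigraded := (HredA_delb x.2, 0).

Fact HABC_del_linear : linear HABC_del_fun.
Proof.
move=> c x y; apply: injective_projections; first exact: linearP.
by rewrite /= scaler0 addr0.
Qed.
HB.instance Definition _ := GRing.isLinear.Build k HABC_bigraded HABC_bigraded
  *:%R HABC_del_fun HABC_del_linear.
Fact HABC_delb_linear : linear HABC_delb_fun.
Proof.
move=> c x y; apply: injective_projections; first exact: linearP.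
by rewrite /= scaler0 addr0.
Qed.
HB.instance Definition _ := GRing.isLinear.Build k HABC_bigraded HABC_bigraded
  *:%R HABC_delb_fun HABC_delb_linear.

Definition HABC_del : {linear HABC_bigraded -> HABC_bigraded} := HABC_del_fun.
Definition HABC_delb : {linear HABC_bigraded -> HABC_bigraded} := HABC_delb_fun.

Fact HABC_del_bidegree : has_bidegree (1, 0) HABC_del.
Proof.
move=> i [c a] /(congr1 snd) ha.
have [z def_a] : exists z, a = cls (subspace_map (@cocyclesA_proj i) z).
  have [z def_a] := cls_surj a; exists z.
  have <- : subquot_proj cocyclesA_proj bounds_redA_proj i a = a by exact: ha.
  by rewrite def_a; exact: subquot_mapE.
apply: injective_projections; last exact: (raddf0 (proj _)).
change (subquot_proj cocyclesBC_proj boundsBC_proj (i + (1, 0)) (HredA_del a) =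
        HredA_del a).
rewrite def_a HredA_delE /subquot_proj subquot_mapE; congr (cls _).
by apply: val_inj; rewrite /= -del_proj proj_idem.
Qed.
Fact HABC_delb_bidegree : has_bidegree (0, 1) HABC_delb.
Proof.
move=> i [c a] /(congr1 snd) ha.
have [z def_a] : exists z, a = cls (subspace_map (@cocyclesA_proj i) z).
  have [z def_a] := cls_surj a; exists z.
  have <- : subquot_proj cocyclesA_proj bounds_redA_proj i a = a by exact: ha.
  by rewrite def_a; exact: subquot_mapE.
apply: injective_projections; last exact: (raddf0 (proj _)).
change (subquot_proj cocyclesBC_proj boundsBC_proj (i + (0, 1)) (HredA_delb a) =
        HredA_delb a).
rewrite def_a HredA_delbE /subquot_proj subquot_mapE; congr (cls _).
by apply: val_inj; rewrite /= -delb_proj proj_idem.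
Qed.
Fact HABC_del_del x : HABC_del (HABC_del x) = 0.
Proof. by apply: injective_projections; first exact: (raddf0 HredA_del). Qed.
Fact HABC_delb_delb x : HABC_delb (HABC_delb x) = 0.
Proof. by apply: injective_projections; first exact: (raddf0 HredA_delb). Qed.
Fact HABC_del_delb x : HABC_del (HABC_delb x) + HABC_delb (HABC_del x) = 0.
Proof.
apply: injective_projections; last exact: addr0.
by rewrite -[RHS]addr0; congr (_ + _); [exact: (raddf0 HredA_del) |
   exact: (raddf0 HredA_delb)].
Qed.

(** [HABC] is H_ABC(A), whose elements are the pairs (c, a) with c in H_BC(A)
    and a in \widetilde H_A(A). *)
Definition HABC : bicomplex k := Bicomplex HABC_del_bidegree HABC_delb_bidegree
  HABC_del_del HABC_delb_delb HABC_del_delb.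

Definition inBC (c : HBC) : HABC := (c, 0).

Lemma HABC_minimal : minimal HABC.
Proof. by move=> x; apply: injective_projections; first exact: (raddf0 HredA_del). Qed.

End Cohomology.
Arguments cocyclesBC {k} A.
Arguments cocyclesA {k} A.
Arguments boundsBC {k} A.
Arguments boundsA {k} A.
Arguments bounds_redA {k} A.

Section ContractionHABC.
Variables (k : fieldType) (A : bicomplex k) (C : contraction A (HABC A)).

Fact contr_g_cocyclesBC c : contr_g C (inBC c) \in cocyclesBC A.
Proof.
rewrite inE -bc_fun_del -bc_fun_delb.
suff [-> ->] : del (inBC c) = 0 /\ delb (inBC c) = 0 by rewrite !raddf0 eqxx.
by split; apply: injective_projections => //;
   [exact: (raddf0 (HredA_del _)) | exact: (raddf0 (HredA_delb _))].
Qed.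

(** The cocycle g([x]), for [x] in H_BC(A). *)
Definition contr_gBC (c : HBC A) : subspace (cocyclesBC A) :=
  Subspace (contr_g_cocyclesBC c).

Fact contr_g_cocyclesA b : contr_g C b \in cocyclesA A.
Proof. by rewrite inE -bc_fun_delb -bc_fun_del HABC_minimal raddf0. Qed.

Definition contr_gA (b : HABC A) : subspace (cocyclesA A) :=
  Subspace (contr_g_cocyclesA b).

(** g([x]) is a Bott-Chern cocycle representing [x], for all [x] in H_BC(A). *)
Definition represents_HBC := forall c : HBC A, cls (contr_gBC c) = c.

End ContractionHABC.

(** The total degree of a homogeneous element of bidegree i is i.1 + i.2. *)
Definition derivation (k : fieldType) (V : bigraded k)
    (m : {bilinear V -> V -> V}) (D : V -> V) :=
  forall i a b, homog i a ->
    D (m a b) = m (D a) b + ((-1 : k) ^ (i.1 + i.2)) *: m a (D b).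

Record bba (k : fieldType) := Bba {
  bba_bc :> bicomplex k;
  bmul : {bilinear bba_bc -> bba_bc -> bba_bc};
  mulA : forall a b c, bmul a (bmul b c) = bmul (bmul a b) c;
  mul_bidegree : forall i j a b, homog i a -> homog j b -> homog (i + j) (bmul a b);
  del_derivation : derivation bmul del;
  delb_derivation : derivation bmul delb
}.
Arguments bmul {k} {_}.

Section Algebra.
Variables (k : fieldType) (A : bba k).

Lemma derivation_mulr (D : {linear A -> A}) (a b : A) :
  derivation bmul D -> D b = 0 -> D (bmul a b) = bmul (D a) b.
Proof.
move=> derD Db; have [s _ ->] := proj_sum a.
rewrite linear_sumlz !raddf_sum linear_sumlz; apply: eq_bigr => i _ /=.
by rewrite (derD _ _ _ (proj_homog i a)) Db linear0r scaler0 addr0.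
Qed.

Lemma del_delb_mull (x v : A) :
  x \in cocyclesBC A -> del (delb (bmul x v)) = bmul x (del (delb v)).
Proof.
move=> hx; have [s _ def_x] := proj_sum x.
rewrite def_x !linear_sumlz !raddf_sum; apply: eq_bigr => i _ /=.
have := @cocyclesBC_proj _ A i x hx; rewrite inE => /andP[/eqP dx /eqP dbx].
rewrite (delb_derivation _ (proj_homog i x)) dbx linear0l add0r linearZ /=.
rewrite (del_derivation _ (proj_homog i x)) dx linear0l add0r scalerA.
by rewrite -expfzMl mulrNN mulr1 exp1rz scale1r.
Qed.

Lemma del_delb_mulr (u z : A) :
  z \in cocyclesBC A -> del (delb (bmul u z)) = bmul (del (delb u)) z.
Proof.
rewrite inE => /andP[/eqP dz /eqP dbz].
rewrite (derivation_mulr _ (@delb_derivation _ A) dbz).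
exact: derivation_mulr (@del_derivation _ A) dz.
Qed.

Fact mul_cocyclesBC (x y : A) : x \in cocyclesBC A -> y \in cocyclesBC A ->
  bmul x y \in cocyclesBC A.
Proof.
rewrite !inE => /andP[/eqP dx /eqP dbx] /andP[/eqP dy /eqP dby].
rewrite (derivation_mulr _ (@delb_derivation _ A) dby).
rewrite (derivation_mulr _ (@del_derivation _ A) dy).
by rewrite dx dbx !linear0l eqxx.
Qed.

Definition mulBC_cocycles (x y : subspace (cocyclesBC A)) :
    subspace (cocyclesBC A) :=
  Subspace (mul_cocyclesBC (subspace_valP x) (subspace_valP y)).

(** The product of H_BC(A); [mulBC_cls] shows that it does not depend on the
    choice of representatives. *)
Definition mulBC (c c' : HBC A) : HBC A := cls (mulBC_cocycles (rep c) (rep c')).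

Lemma mulBC_cls (x y : subspace (cocyclesBC A)) :
  mulBC (cls x) (cls y) = cls (mulBC_cocycles x y).
Proof.
have /clsP := repK (cls x : HBC A); rewrite inE => -[b def_x].
have /clsP := repK (cls y : HBC A); rewrite inE => -[c def_y].
apply/clsP; rewrite inE /=; set x' := rep _ in def_x *; set y' := rep _ in def_y *.
exists (bmul b (subspace_val y') + bmul (subspace_val x) c).
rewrite !raddfD /= del_delb_mulr ?subspace_valP // del_delb_mull ?subspace_valP //.
by rewrite -def_x -def_y linearBr linearBl addrA subrK.
Qed.

Section Massey.
Variables x y z : subspace (cocyclesBC A).

Fact massey_cocyclesA (u v : A) :
  del (delb u) = bmul (subspace_val x) (subspace_val y) ->
  del (delb v) = bmul (subspace_val y) (subspace_val z) ->
  bmul (subspace_val x) v - bmul u (subspace_val z) \in cocyclesA A.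
Proof.
move=> hu hv; rewrite inE !raddfB /= del_delb_mull ?subspace_valP //.
by rewrite del_delb_mulr ?subspace_valP // hu hv mulA subrr.
Qed.

(** As a subset of H_A(A), this depends on the chosen cocycles x, y, z. *)
Definition massey : set (HA A) := [set c | exists (u v : A)
  (hu : del (delb u) = bmul (subspace_val x) (subspace_val y))
  (hv : del (delb v) = bmul (subspace_val y) (subspace_val z)),
  c = cls (Subspace (massey_cocyclesA hu hv))].

End Massey.

(** The transferred operation. No Koszul signs arise when it is evaluated, as
    f, g, h and the product all have even total degree. *)
Definition mu3 (C : contraction A (HABC A)) (a b c : HABC A) : HABC A :=
  let f := contr_f C in let g := contr_g C in let h := contr_h C in
  f (bmul (h (bmul (g a) (g b))) (g c)) - f (bmul (g a) (h (bmul (g b) (g c)))).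

End Algebra.

(* Main.v *)
Require Import Defs.
From mathcomp Require Import all_boot all_order all_algebra.
From mathcomp Require Import boolp classical_sets.
Import GRing.Theory.
Local Open Scope ring_scope.

(** The contraction identity reads
    g f a - a = del delb h a - del h delb a + delb h del a + h del delb a.
    On a Bott-Chern boundary a, minimality of H_ABC kills g f a, so
    del delb (- h a) = a. Hence u = - h (x y) and v = - h (y z) are admissible
    choices, and for them w = x v - u z = h (x y) z - x h (y z), so that
    mu_3 = f w. As del delb w = 0, the identity shows that g f w and w have the
    same Aeppli class. *)

Section ContractionIdentity.
Context {k : fieldType} {A B : bicomplex k} (C : contraction A B).
Local Notation f := (contr_f C).
Local Notation g := (contr_g C).
Local Notation h := (contr_h C).

Lemma contr_gfE (a : A) :
  g (f a) - a = del (delb (h a) - h (delb a)) + delb (h (del a))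
                + h (del (delb a)).
Proof.
rewrite contr_gf /gcomm /=.
have -> : (-1 : k) ^ (1 * -2) = 1 by rewrite mul1r -exprnN sqrrN expr1n invr1.
have -> : (-1 : k) ^ (1 * -1) = -1 by rewrite mul1r -exprnN expr1 invrN invr1.
by rewrite !scale1r scaleN1r opprK delbE raddfN opprK addrA.
Qed.

(** The term [h (del (delb a))] vanishes on an Aeppli cocycle, and the remaining terms lie in Im del
    + Im delb. *)
Lemma contr_gf_boundsA (a : A) : a \in cocyclesA A -> g (f a) - a \in boundsA A.
Proof.
rewrite !inE => /eqP a0.
by rewrite contr_gfE a0 raddf0 addr0; do 2 eexists.
Qed.

Lemma del_delb_contr_h (a : A) : minimal B -> a \in boundsBC A ->
  del (delb (- h a)) = a.
Proof.
move=> minB; rewrite inE => -[b def_a].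
have da : del a = 0 by rewrite def_a del_del.
have dba : delb a = 0 by rewrite def_a delbE delb_delb raddf0 oppr0.
have := contr_gfE a.
have -> : f a = 0 by rewrite def_a bc_fun_del bc_fun_delb minB.
rewrite da dba !raddf0 !addr0 add0r => def_Na.
by rewrite (raddfN delb) (raddfN del) /= -def_Na opprK.
Qed.

End ContractionIdentity.

Lemma mulBC_eq0 {k : fieldType} {A : bba k} (x y : subspace (cocyclesBC A)) :
  mulBC (cls x) (cls y) = 0 ->
  bmul (subspace_val x) (subspace_val y) \in boundsBC A.
Proof.
by rewrite mulBC_cls -(raddf0 cls) => /clsP; rewrite !raddf0 addr0.
Qed.

Theorem proposition2p36 (k : fieldType) (char0 : [pchar k] =i pred0)
    (A : bba k) (H : bicomplex k) (minH : minimal H)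
    (C0 : contraction A H) (phi : bc_iso H (HABC A))
    (phiBC : represents_HBC (contr_iso C0 phi))
    (X Y Z : HBC A) (XY : mulBC X Y = 0) (YZ : mulBC Y Z = 0) :
  let C := contr_iso C0 phi in
  massey (contr_gBC C X) (contr_gBC C Y) (contr_gBC C Z)
    (cls (contr_gA C (mu3 C (inBC X) (inBC Y) (inBC Z))) : HA A).
Proof.
move: (contr_iso C0 phi) phiBC => C phiBC /=.
(* By [phiBC] the cocycles [g X], [g Y], [g Z] represent the classes, so the products of these very
   cocycles are Bott-Chern boundaries. *)
rewrite -(phiBC X) -(phiBC Y) in XY; rewrite -(phiBC Y) -(phiBC Z) in YZ.
have hu := del_delb_contr_h C _ (@HABC_minimal _ A) (mulBC_eq0 _ _ XY).
have hv := del_delb_contr_h C _ (@HABC_minimal _ A) (mulBC_eq0 _ _ YZ).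
exists _, _, hu, hv; apply/clsP.
(* Replacing [mu3] by [f w] gives the goal the form [g (f w) - w]; the two minus signs of u and v
   account for the order of the terms. *)
rewrite [subspace_val _]/= [X in contr_g C X](_ : _ = contr_f C
    (subspace_val (Subspace (massey_cocyclesA hu hv)))).
  exact: contr_gf_boundsA (massey_cocyclesA hu hv).
by rewrite /mu3 /= linearNr linearNl opprK [in RHS]addrC raddfB.
Qed.
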